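(* Let $p\ge1$, and let $\mathbf{s}=(s_1,\dots,s_p)\in\mathbb{N}^p$ and $\mathbf{x}=(x_1,\dots,x_p)\in\mathbb{C}^p$ with $\max_k|x_k|<1$ be fixed. Then $$\lim_{n\to\infty}\mathbb{E}\left[Z_n^{\mathbf{s}}(\mathbf{x})\right]=\prod_{\mathbf{k}\in\mathbb{N}^p\setminus\{0\}}\left(1-\mathbf{x}^{\mathbf{k}}\right)^{-\binom{\mathbf{s}}{\mathbf{k}}(-1)^{\mathbf{k}}}.$$
   Context: $\mathbb{N}=\{0,1,2,\dots\}$. $S_n$ is identified with the group of $n\times n$ permutation matrices $g=(\delta_{i,\sigma(j)})_{1\le i,j\le n}$. For $g\in S_n$, $Z_n^{\mathbf{s}}(\mathbf{x})(g):=\prod_{k=1}^p\det(I-x_kg)^{s_k}$, and $\mathbb{E}$ is expectation with respect to the uniform measure on $S_n$. Notation: $\mathbf{x}^{\mathbf{k}}:=\prod_{j=1}^p x_j^{k_j}$ and $\binom{\mathbf{s}}{\mathbf{k}}(-1)^{\mathbf{k}}:=\prod_{j=1}^p\binom{s_j}{k_j}(-1)^{k_j}$; only finitely many of these exponents are nonzero. *)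

(* Defs.v *)
From HB Require Import structures.
From mathcomp Require Import all_boot all_order all_algebra all_fingroup.
From mathcomp Require Import all_classical all_reals all_analysis.
From mathcomp Require Export complex.

Set Implicit Arguments.
Unset Strict Implicit.
Unset Printing Implicit Defensive.

Import Order.TTheory GRing.Theory Num.Theory.

Local Open Scope ring_scope.

(* Entry (i, j) is delta_{i, sigma(j)}. The library's [perm_mx sigma] is the
   transpose: its entry (i, j) is delta_{sigma(i), j}. *)
Definition permutation_matrix (F : fieldType) (n : nat) (sigma : 'S_n) : 'M[F]_n :=
  \matrix_(i < n, j < n) (i == sigma j)%:R.

Definition Zpoly (F : fieldType) (p : nat) (s : 'I_p -> nat) (x : 'I_p -> F)
    (n : nat) (sigma : 'S_n) : F :=
  \prod_(k < p) (\det (1%:M - x k *: permutation_matrix F sigma)) ^+ s k.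

(* Expectation of a complex-valued function under the uniform measure on S_n,
   written as an average because the library's ['E_P] is real-valued. *)
Definition unif_expect (F : fieldType) (n : nat) (f : 'S_n -> F) : F :=
  (#|[set: 'S_n]|%:R)^-1 * \sum_(sigma : 'S_n) f sigma.

Definition mpow (F : fieldType) (p : nat) (x : 'I_p -> F)
    (k : {ffun 'I_p -> nat}) : F :=
  \prod_(j < p) x j ^+ k j.

Definition signed_binom (p : nat) (s : 'I_p -> nat) (k : {ffun 'I_p -> nat}) : int :=
  \prod_(j < p) (('C(s j, k j))%:Z * (-1) ^+ k j).

(* Main.v *)
(* Let h(l) = prod_k (1 - x_k^l)^(s_k). Since det(I - x g) is the product of
   1 - x^l over the cycle lengths l of g, the means E_n satisfy
   n E_n = sum_(1 <= l <= n) h(l) E_(n-l). This is proved without cycles, by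
   eliminating one at a time the images of a marked point from the determinant.
   The recursion says that sum_n E_n z^n = exp(sum_(l >= 1) h(l) z^l / l). The
   binomial theorem gives h(l) = sum_k c_k (x^k)^l over multi-indices k, with c_k
   the signed binomials and c_0 = 1, so the series is
   (1 - z)^(-1) prod_(k <> 0) (1 - x^k z)^(-c_k). Starting from the constant
   sequence 1, whose series is (1 - z)^(-1), multiplying or dividing the series by
   1 - y z with |y| < 1 preserves convergence of the coefficients and multiplies
   or divides their limit by 1 - y. *)
Require Import Defs.
From HB Require Import structures.
From mathcomp Require Import all_boot all_order all_algebra all_fingroup.
From mathcomp Require Import all_classical all_reals all_analysis.
From mathcomp Require Import complex.
From mathcomp Require Import ring.
Import Order.TTheory GRing.Theory Num.Theory.
Import numFieldNormedType.Exports.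
Local Open Scope classical_set_scope.
Local Open Scope ring_scope.

(** * Determinants of permutation matrices with a marked row *)

(* On the rows indexed by a cycle of [sigma] of length [l], [1 - x sigma] has
   determinant [1 - x ^ l]; on the cycle through [ord0] the mark changes this
   factor to [1 - a x ^ (l - 1)]. *)
Definition marked_mx {F : fieldType} {n : nat} (a x : F) (sigma : 'S_n.+1) : 'M[F]_n.+1 :=
  \matrix_(i, j) ((i == j)%:R - (if i == ord0 then a else x) * (sigma i == j)%:R).

Lemma det_permutation_matrix (F : fieldType) (n : nat) (x : F) (sigma : 'S_n) :
  \det (1%:M - x *: permutation_matrix F sigma) = \det (1%:M - x *: perm_mx sigma).
Proof.
rewrite -det_tr; congr (\det _); apply/matrixP => i j.
by rewrite !mxE eq_sym (eq_sym j (sigma i)).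
Qed.

Lemma det_marked_mx_diag (F : fieldType) (n : nat) (x : F) (sigma : 'S_n.+1) :
  \det (marked_mx x x sigma) = \det (1%:M - x *: perm_mx sigma).
Proof. by congr (\det _); apply/matrixP => i j; rewrite !mxE if_same. Qed.

Lemma det_marked_mx_fixed (F : fieldType) (n : nat) (a x : F) (tau : 'S_n) :
  \det (marked_mx a x (lift_perm ord0 ord0 tau)) =
  (1 - a) * \det (1%:M - x *: perm_mx tau).
Proof.
rewrite (expand_det_row _ ord0) (bigD1 ord0) //= big1 ?addr0 => [|j j0]; last first.
  by rewrite !mxE lift_perm_id (eq_sym ord0) (negbTE j0) mulr0 subr0 mul0r.
rewrite !mxE lift_perm_id !eqxx mulr1 /cofactor expr0 mul1r; congr (_ * \det _).
by apply/matrixP => i j; rewrite !mxE lift_perm_lift !(inj_eq lift_inj) lift_eqF.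
Qed.

(* Adding [a] times row [j] to row [ord0] clears column [j] outside the
   diagonal: [j = sigma ord0] is cut out of the cycle of [ord0], and the mark
   picks up the factor [x]. *)
Lemma det_marked_mx_shortcut (F : fieldType) (n : nat) (a x : F) (j : 'I_n.+2)
    (tau : 'S_n.+1) : j != ord0 ->
  \det (marked_mx a x (tperm ord0 j * lift_perm j j tau)%g) =
  \det (marked_mx (a * x) x tau).
Proof.
move=> j0; set sigma := (_ * _)%g; set M := marked_mx _ _ _.
have s0 : sigma ord0 = j by rewrite permM tpermL lift_perm_id.
have l0 : lift j ord0 = ord0 by apply: val_inj; rewrite /= /bump leqn0 [_ == _](negbTE j0).
have sj : sigma j = lift j (tau ord0) by rewrite permM tpermR -{1}l0 lift_perm_lift.
have sl (u : 'I_n.+1) : u != ord0 -> sigma (lift j u) = lift j (tau u).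
  move=> u0; rewrite permM tpermD ?lift_perm_lift ?neq_lift //.
  by rewrite -l0 (inj_eq lift_inj) eq_sym.
pose M' : 'M[F]_n.+2 :=
  \matrix_(i, k) (if i == ord0 then M ord0 k + a * M j k else M i k).
(* [M0] carries row [j] twice, so its determinant vanishes and multilinearity in row [ord0] gives
   [\det M = \det M']. *)
pose M0 : 'M[F]_n.+2 := \matrix_(i, k) (if i == ord0 then M j k else M i k).
have -> : \det M = \det M'.
  rewrite (@determinant_multilinear _ _ M' M M0 ord0 1 a).
  - rewrite mul1r (@determinant_alternate _ _ M0 ord0 j) ?mulr0 ?addr0 //.
      by rewrite eq_sym.
    by move=> k; rewrite !mxE eqxx (negbTE j0).
  - by apply/rowP => k; rewrite !mxE !eqxx mul1r.
  - by apply/matrixP => i k; rewrite !mxE lift_eqF.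
  - by apply/matrixP => i k; rewrite !mxE lift_eqF.
rewrite (expand_det_col _ j) (bigD1 j) //= big1 ?addr0 => [|i ij]; last first.
  rewrite !mxE (negbTE ij) eqxx sj lift_eqF s0 eqxx (eq_sym ord0) (negbTE j0).
  have [_|i0] := eqVneq i ord0; first by rewrite /=; ring.
  case: (unliftP j i) ij i0 => [u ->|->]; last by rewrite eqxx.
  move=> _; rewrite -l0 (inj_eq lift_inj) => u0.
  by rewrite sl // lift_eqF mulr0 subr0 mul0r.
rewrite !mxE (negbTE j0) eqxx sj lift_eqF mulr0 subr0 mul1r /cofactor.
rewrite -signr_odd oddD addbb expr0 mul1r; congr (\det _).
apply/matrixP => u v; rewrite !mxE.
have [->|u0] := eqVneq u ord0.
  rewrite l0 !eqxx s0 sj (negbTE j0) (inj_eq lift_inj) (negbTE (neq_lift _ _)).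
  by rewrite -[X in X == _]l0 (inj_eq lift_inj) /=; ring.
have lu0 : (lift j u == ord0) = false by rewrite -l0 (inj_eq lift_inj) (negbTE u0).
by rewrite lu0 sl // !(inj_eq lift_inj).
Qed.

(** * Recursion for the means over the symmetric groups *)

Lemma sum_perm_recl (V : nmodType) (n : nat) (f : 'S_n.+1 -> V) :
  \sum_(sigma : 'S_n.+1) f sigma =
  \sum_(j < n.+1) \sum_(tau : 'S_n) f (tperm ord0 j * lift_perm j j tau)%g.
Proof.
rewrite pair_big /=.
(* [u.1] is the image of [ord0], and [u.2] the permutation left on the other points once [u.1] is
   cut out. Counting turns injectivity into bijectivity. *)
pose g (u : 'I_n.+1 * 'S_n) := (tperm ord0 u.1 * lift_perm u.1 u.1 u.2)%g.
have ginj : injective g.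
  move=> [j s] [k t] gE.
  have gl i r : g (i, r) ord0 = i by rewrite permM tpermL lift_perm_id.
  have jk : j = k by rewrite -(gl j s) gE gl.
  move: gE; rewrite -jk => /mulgI /permP st; congr (_, _); apply/permP => i.
  by have := st (lift j i); rewrite !lift_perm_lift => /lift_inj.
by rewrite (reindex g) //=; apply/onW_bij/inj_card_bij => //; rewrite card_prod card_ord !card_Sn factS.
Qed.

(** The contribution of one cycle of length [l] to [Zpoly]. *)
Definition cycle_weight {F : fieldType} {p : nat} (s : 'I_p -> nat) (x : 'I_p -> F)
  (l : nat) : F := \prod_(k < p) (1 - x k ^+ l) ^+ s k.

Section Recursion.
Variables (F : numFieldType) (p : nat) (s : 'I_p -> nat) (x : 'I_p -> F).

Local Notation perm_sum n := (\sum_(sigma : 'S_n) Zpoly s x sigma).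

(** The marks [a] stay free because cutting out a point turns [a k] into [a k * x k]. *)
Let marked_sum n (a : 'I_p -> F) : F :=
  \sum_(sigma : 'S_n.+1) \prod_(k < p) \det (marked_mx (a k) (x k) sigma) ^+ s k.

Let unmarked_term n (a : 'I_p -> F) :
  \sum_(tau : 'S_n) \prod_(k < p)
    \det (marked_mx (a k) (x k) (tperm ord0 ord0 * lift_perm ord0 ord0 tau)%g) ^+ s k
  = (\prod_(k < p) (1 - a k) ^+ s k) * perm_sum n.
Proof.
rewrite big_distrr; apply: eq_bigr => tau _ /=.
rewrite -big_split; apply: eq_bigr => k _ /=.
by rewrite tperm1 mul1g det_marked_mx_fixed det_permutation_matrix exprMn.
Qed.

Let marked_sum0 a : marked_sum 0 a = (\prod_(k < p) (1 - a k) ^+ s k) * perm_sum 0.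
Proof. by rewrite /marked_sum sum_perm_recl big_ord_recl big_ord0 addr0 unmarked_term. Qed.

Let marked_sumS n a : marked_sum n.+1 a =
  (\prod_(k < p) (1 - a k) ^+ s k) * perm_sum n.+1
  + n.+1%:R * marked_sum n (fun k => a k * x k).
Proof.
rewrite /marked_sum sum_perm_recl big_ord_recl unmarked_term; congr (_ + _).
rewrite mulr_natl -[X in _ *+ X]card_ord -sumr_const; apply: eq_bigr => j _.
apply: eq_bigr => tau _; apply: eq_bigr => k _.
by rewrite det_marked_mx_shortcut // eq_sym neq_lift.
Qed.

Lemma unif_expectE n (f : 'S_n -> F) :
  unif_expect f = (n`!%:R)^-1 * \sum_(sigma : 'S_n) f sigma.
Proof. by rewrite /unif_expect cardsT card_Sn. Qed.

Let fact_neq0 n : n`!%:R != 0 :> F.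
Proof. by rewrite pnatr_eq0 -lt0n fact_gt0. Qed.

Let E n := unif_expect (fun sigma : 'S_n => Zpoly s x sigma).

Let perm_sumE n : perm_sum n = n`!%:R * E n.
Proof. by rewrite /E unif_expectE mulrA divff ?mul1r. Qed.

(** Unrolls [marked_sumS]: [l] counts the points cut out before [ord0] becomes fixed, so its cycle
    had length [l + 1]. *)
Let marked_sum_conv n a : marked_sum n a = n`!%:R *
  \sum_(l < n.+1) (\prod_(k < p) (1 - a k * x k ^+ l) ^+ s k) * E (n - l).
Proof.
elim: n a => [|n IHn] a.
  rewrite marked_sum0 perm_sumE big_ord1 mulrCA; congr (_ * (_ * _)).
  by apply: eq_bigr => k _; rewrite expr0 mulr1.
rewrite marked_sumS perm_sumE IHn [in RHS]big_ord_recl mulrDr subn0; congr (_ + _).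
  rewrite mulrCA; congr (_ * (_ * _)).
  by apply: eq_bigr => k _; rewrite expr0 mulr1.
rewrite mulrA -natrM -factS; congr (_ * _); apply: eq_bigr => l _.
by rewrite subSS; congr (_ * _); apply: eq_bigr => k _; rewrite exprS mulrA.
Qed.

Lemma unif_expect_Zpoly0 : E 0 = 1.
Proof.
rewrite /E unif_expectE fact0 invr1 mul1r (eq_bigr (fun=> 1)) => [|sigma _].
  by rewrite sumr_const card_Sn.
by rewrite /Zpoly big1 // => k _; rewrite det_mx00 expr1n.
Qed.

Lemma unif_expect_Zpoly_rec n : n.+1%:R * E n.+1 =
  \sum_(l < n.+1) cycle_weight s x l.+1 * E (n - l).
Proof.
apply: (mulfI (fact_neq0 n)).
rewrite mulrA -natrM -(mulnC n.+1) -factS -perm_sumE.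
(* Marks equal to [x] change nothing, and then [a k * x k ^+ l] is [x k ^+ l.+1]. *)
have -> : perm_sum n.+1 = marked_sum n x.
  apply: eq_bigr => sigma _; apply: eq_bigr => k _.
  by rewrite det_permutation_matrix det_marked_mx_diag.
rewrite marked_sum_conv; congr (_ * _); apply: eq_bigr => l _; congr (_ * _).
by apply: eq_bigr => k _; rewrite exprS.
Qed.

End Recursion.

(** * Linear factors of generating series *)

Section FactorRecursion.
Variable F : numFieldType.
Implicit Types (h a b : nat -> F) (y : F).

Definition exp_conv h a n : F := \sum_(l < n.+1) h l.+1 * a (n - l)%N.

(* The coefficientwise form of [z A'(z) = (sum_(l >= 1) h l z ^ l) A(z)], that is
   of [A(z) = exp (sum_(l >= 1) h l z ^ l / l)]; the value [h 0] is never used. *)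
Definition exp_rec h a : Prop := a 0%N = 1 /\ forall n, n.+1%:R * a n.+1 = exp_conv h a n.

Lemma exp_rec_uniq h a b : exp_rec h a -> exp_rec h b -> a =1 b.
Proof.
move=> [a0 aS] [b0 bS] n; elim/ltn_ind: n => -[_|n IHn]; first by rewrite a0 b0.
apply: (@mulfI _ n.+1%:R); first by rewrite pnatr_eq0.
rewrite aS bS; apply: eq_bigr => l _; rewrite IHn //.
by rewrite ltnS leq_subr.
Qed.

(** In series, [A = (1 - y z) B], and the sum of [(y z) ^ l] over [l >= 1] is [y z / (1 - y z)]; the
    product is [y z B]. *)
Lemma exp_conv_geo y a b n : a 0%N = b 0%N -> (forall m, a m.+1 = b m.+1 - y * b m) ->
  exp_conv (fun l => y ^+ l) a n = y * b n.
Proof.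
move=> a0 aS; elim: n => [|n IHn]; first by rewrite /exp_conv big_ord1 a0 expr1.
rewrite /exp_conv big_ord_recl subn0 expr1.
transitivity (y * a n.+1 + y * exp_conv (fun l => y ^+ l) a n).
  congr (_ + _); rewrite /exp_conv big_distrr; apply: eq_bigr => l _ /=.
  by rewrite subSS mulrA -exprS.
by rewrite IHn aS; ring.
Qed.

Lemma exp_convS h a b y n : a 0%N = b 0%N -> (forall m, a m.+1 = b m.+1 - y * b m) ->
  exp_conv h a n.+1 = exp_conv h b n.+1 - y * exp_conv h b n.
Proof.
move=> a0 aS; rewrite /exp_conv big_distrr big_ord_recr [in RHS]big_ord_recr /=.
rewrite subnn a0 addrAC -sumrB; congr (_ + _); apply: eq_bigr => l _.
by rewrite subSn ?aS -1?ltnS //; ring.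
Qed.

(** Coefficient of [z ^ n] in [z A' - H A], where [H] is the sum of [h l z ^ l] over [l >= 1]. *)
Definition exp_defect h a n : F := n%:R * a n - (if n is m.+1 then exp_conv h a m else 0).

(** Both [z A'] and the product of [A] with the new [H] lose the same term [y z B], so the defect
    series is just multiplied by [1 - y z]. *)
Lemma exp_defectS h a b y n : a 0%N = b 0%N -> (forall m, a m.+1 = b m.+1 - y * b m) ->
  exp_defect (fun l => h l - y ^+ l) a n.+1 = exp_defect h b n.+1 - y * exp_defect h b n.
Proof.
move=> a0 aS; rewrite /exp_defect aS.
have -> : exp_conv (fun l => h l - y ^+ l) a n = exp_conv h a n - y * b n.
  rewrite -(exp_conv_geo _ a b n a0 aS) /exp_conv -sumrB.
  by apply: eq_bigr => l _; rewrite mulrBl.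
case: n => [|n]; last by rewrite (exp_convS _ _ b y) // -[in n.+2]addn1 natrD; ring.
by rewrite /exp_conv !big_ord1 a0; ring.
Qed.

Lemma exp_recP h a : exp_rec h a <-> a 0%N = 1 /\ forall n, exp_defect h a n = 0.
Proof.
split=> -[a0 aS]; split=> // n.
  by case: n => [|n]; rewrite /exp_defect ?aS ?subrr ?mul0r ?subr0.
by apply/eqP; rewrite -subr_eq0; apply/eqP/(aS n.+1).
Qed.

(** The series [1 - y z] is invertible, so the two defects vanish together. *)
Lemma exp_rec_factor h a b y :
  a 0%N = b 0%N -> (forall m, a m.+1 = b m.+1 - y * b m) ->
  exp_rec (fun l => h l - y ^+ l) a <-> exp_rec h b.
Proof.
move=> a0 aS; rewrite !exp_recP a0; split=> -[b0 D]; split=> //.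
  elim=> [|n IHn]; first by rewrite /exp_defect mul0r subr0.
  by apply/eqP; rewrite -[_ == _]/(_ == 0) -(D n.+1) (exp_defectS _ _ b) // IHn mulr0 subr0.
case=> [|n]; first by rewrite /exp_defect mul0r subr0.
by rewrite (exp_defectS _ _ b) // !D mulr0 subr0.
Qed.

End FactorRecursion.

(** * Limits of coefficient sequences *)

Lemma cvg0_contracting (R : realType) (q : R) (r d : nat -> R) :
  0 <= q < 1 -> (forall n, 0 <= r n) -> (forall n, r n.+1 <= d n.+1 + q * r n) ->
  d @ \oo --> (0 : R) -> r @ \oo --> (0 : R).
Proof.
move=> /andP[q0 q1] r0 rS d0; apply/cvgrPdist_lt => e e0.
have e20 : 0 < e / 2 by rewrite divr_gt0.
(* This bound on [d] makes [e / 2] the fixed point of [t |-> e / 2 * (1 - q) + q * t]. *)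
have c0 : 0 < e / 2 * (1 - q) by rewrite mulr_gt0 ?subr_gt0.
have [N _ dN] := (cvgrPdist_lt _ _).1 d0 _ c0.
have rN m : r (N + m)%N <= e / 2 + q ^+ m * r N.
  elim: m => [|m IHm]; first by rewrite addn0 mul1r lerDr ltW.
  rewrite addnS; apply: le_trans (rS _) _.
  have dm : d (N + m).+1 <= e / 2 * (1 - q).
    apply: le_trans (ler_norm _) _; rewrite -normrN -[X in `|X|]add0r ltW //.
    by apply: dN; rewrite /= -addnS leq_addr.
  apply: le_trans (lerD dm (ler_wpM2l q0 IHm)) _.
  by rewrite exprS le_eqVlt; apply/orP; left; apply/eqP; ring.
have qr0 : (fun m => q ^+ m * r N) @ \oo --> (0 : R).
  rewrite -(mul0r (r N)); apply: cvgM; last exact: cvg_cst.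
  by apply: cvg_expr; rewrite ger0_norm.
have [M _ qM] := (cvgrPdist_lt _ _).1 qr0 _ e20.
exists (N + M)%N => // n /= NMn.
have nE : n = (N + (n - N))%N by rewrite subnKC // (leq_trans (leq_addr _ _) NMn).
rewrite sub0r normrN ger0_norm // nE; apply: le_lt_trans (rN _) _.
rewrite [ltRHS]splitr ltrD2l; apply: le_lt_trans (ler_norm _) _.
rewrite -normrN -[X in `|X|]add0r; apply: qM.
by rewrite /= leq_subRL // (leq_trans (leq_addr _ _) NMn).
Qed.

Section ComplexLimits.
Variable R : realType.
Implicit Types (u : nat -> R[i]) (l y : R[i]).

Let Re_normK (z : R[i]) : (complex.Re `|z|)%:C%C = `|z|.
Proof. by rewrite RRe_real ?normr_real. Qed.

Let Re_norm_ge0 (z : R[i]) : 0 <= complex.Re `|z|.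
Proof. by rewrite -ler0c Re_normK. Qed.

(** The norm of [R[i]] takes values in [R[i]]; its real part gives access to estimates on real
    sequences. *)
Lemma cvg_Re_normP u l : u @ \oo --> (l : R[i]^o) <->
  (fun n => complex.Re `|u n - l|) @ \oo --> (0 : R).
Proof.
split=> [/(@cvgrPdist_lt R[i] R[i]^o) ul|/cvgrPdist_lt ul].
  apply/cvgrPdist_lt => e e0.
  have eC : 0 < e%:C%C by rewrite ltcR.
  have := ul _ eC; apply: filterS => n une.
  by rewrite sub0r normrN ger0_norm // -ltcR Re_normK distrC.
apply/(@cvgrPdist_lt R[i] R[i]^o) => e e0.
have eE : (complex.Re e)%:C%C = e by rewrite RRe_real // gtr0_real.
have /ul : 0 < complex.Re e by rewrite -ltcR eE.
apply: filterS => n; rewrite sub0r normrN ger0_norm //.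
by rewrite -ltcR Re_normK eE distrC.
Qed.

Lemma cvg_mul_factor (a b : nat -> R[i]) y l :
  (forall m, a m.+1 = b m.+1 - y * b m) ->
  b @ \oo --> (l : R[i]^o) -> a @ \oo --> ((1 - y) * l : R[i]^o).
Proof.
move=> aS bl; rewrite -(@cvg_shiftS R[i]^o).
rewrite (_ : [sequence a n.+1]_n = (fun n => b n.+1 - y * b n)); last exact/funext.
rewrite mulrBl mul1r; apply: (@cvgB _ R[i]^o); first by rewrite (@cvg_shiftS R[i]^o b).
exact: (@cvgZr R[i] R[i]^o _ _ _ y b l bl).
Qed.

(** With [L = l / (1 - y)], the errors satisfy [b n.+1 - L = (a n.+1 - l) + y * (b n - L)], a
    perturbed contraction of ratio [|y|]. *)
Lemma cvg_div_factor (a b : nat -> R[i]) y l : `|y| < 1 ->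
  (forall m, a m.+1 = b m.+1 - y * b m) ->
  a @ \oo --> (l : R[i]^o) -> b @ \oo --> (l / (1 - y) : R[i]^o).
Proof.
move=> y1 aS /cvg_Re_normP al; apply/cvg_Re_normP.
have y0 : 1 - y != 0.
  by rewrite subr_eq0; apply: contraTneq y1 => <-; rewrite normr1 ltxx.
apply: (@cvg0_contracting _ (complex.Re `|y|) _ _ _ _ _ al).
- by rewrite Re_norm_ge0 -ltcR Re_normK.
- by [].
move=> n; rewrite -lecR rmorphD rmorphM /= !Re_normK -normrM.
apply: le_trans (ler_normD _ _); rewrite le_eqVlt; apply/orP; left; apply/eqP.
by congr `|_|; rewrite aS; field.
Qed.

Definition exp_limit (h : nat -> R[i]) l : Prop :=
  exists2 a : nat -> R[i], exp_rec R[i] h a & a @ \oo --> (l : R[i]^o).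

Lemma exp_limit1 : exp_limit (fun=> 1) 1.
Proof.
exists (fun=> 1); last exact: (@cvg_cst R[i]^o).
split=> // n; rewrite /exp_conv (eq_bigr (fun=> 1)) => [|l _]; last by rewrite mulr1.
by rewrite sumr_const card_ord mulr1.
Qed.

Lemma exp_limit_mul h l y : exp_limit h l ->
  exp_limit (fun n => h n - y ^+ n) ((1 - y) * l).
Proof.
case=> b hb bl; pose a n := if n is m.+1 then b n - y * b m else b 0%N.
exists a; last exact: cvg_mul_factor bl.
exact/(exp_rec_factor _ h a b y).
Qed.

Lemma exp_limit_div h l y : `|y| < 1 -> exp_limit h l ->
  exp_limit (fun n => h n + y ^+ n) (l / (1 - y)).
Proof.
move=> y1 [a ha al].
pose b := fix b n := if n is m.+1 then a n + y * b m else a 0%N.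
have aS m : a m.+1 = b m.+1 - y * b m by rewrite /= addrK.
exists b; last exact: cvg_div_factor al.
apply/(exp_rec_factor _ _ a b y) => //.
by rewrite (_ : (fun _ => _) = h) //; apply/funext => n; rewrite addrK.
Qed.

Let exp_limit_eq h h' l l' : h =1 h' -> l = l' -> exp_limit h l -> exp_limit h' l'.
Proof. by move=> /funext -> ->. Qed.

(** Induction on the integer [c]: each step up divides the series by [1 - y z], each step down
    multiplies by it. *)
Lemma exp_limit_exprz h l y (c : int) : `|y| < 1 -> exp_limit h l ->
  exp_limit (fun n => h n + c%:~R * y ^+ n) ((1 - y) ^ (- c) * l).
Proof.
move=> y1 hl; have y0 : 1 - y != 0.
  by rewrite subr_eq0; apply: contraTneq y1 => <-; rewrite normr1 ltxx.
elim/int_rec: c => [|n IHn|n IHn].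
- apply: exp_limit_eq hl => [n|]; last by rewrite oppr0 expr0z mul1r.
  by rewrite mul0r addr0.
- apply: exp_limit_eq (exp_limit_div _ _ _ y1 IHn) => [m|].
    by rewrite [in RHS]intS intrD mulrDl mul1r [in RHS]addrCA addrC.
  by rewrite [in RHS]intS opprD expfzDr // exprN1 mulrAC -mulrA mulrCA mulrA.
- apply: exp_limit_eq (exp_limit_mul _ _ y IHn) => [m|].
    by rewrite [in RHS]intS !opprD intrD mulrDl mulN1r [in RHS]addrCA addrC.
  by rewrite [in RHS]intS !opprK expfzDr // expr1z mulrA.
Qed.

Lemma exp_limit_prod (I : Type) (r : seq I) (P : pred I) (y : I -> R[i]) (c : I -> int) :
  (forall i, P i -> `|y i| < 1) ->
  exp_limit (fun n => 1 + \sum_(i <- r | P i) (c i)%:~R * y i ^+ n)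
    (\prod_(i <- r | P i) (1 - y i) ^ (- c i)).
Proof.
move=> y1; elim: r => [|i r IHr].
  by rewrite big_nil; under eq_fun do rewrite big_nil addr0; exact: exp_limit1.
under eq_fun do rewrite big_cons.
rewrite big_cons; case: ifP => [Pi|_]; last exact: IHr.
apply: exp_limit_eq (exp_limit_exprz _ _ _ (c i) (y1 _ Pi) IHr) => // n.
by rewrite [RHS]addrCA [RHS]addrC.
Qed.

End ComplexLimits.

(** * Expansion of cycle weights over multi-indices *)

Section CycleWeight.
Variable p : nat.
Implicit Types (s : 'I_p -> nat) (k : {ffun 'I_p -> nat}).

(** A range [N] common to all factors lets their product be distributed over one finite function
    type; the added binomials are zero. *)
Lemma exprB1_widen (F : comNzRingType) (z : F) (n N : nat) : (n <= N)%N ->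
  (1 - z) ^+ n = \sum_(i < N.+1) (('C(n, i))%:Z * (-1) ^+ i)%:~R * z ^+ i.
Proof.
move=> nN; rewrite exprBn.
rewrite (big_ord_widen N.+1 (fun i => (-1) ^+ i * 1 ^+ (n - i) * z ^+ i *+ 'C(n, i))) //.
rewrite big_mkcond; apply: eq_bigr => i _; case: ltnP => ni.
  by rewrite expr1n mulr1 intrM rmorphXn rmorphN1 -mulrA mulr_natl.
by rewrite bin_small // mul0r mul0r.
Qed.

Definition bounded_multiindices (N : nat) : seq {ffun 'I_p -> nat} :=
  [seq [ffun j => nat_of_ord (f j)] | f : {ffun 'I_p -> 'I_N.+1}].

Lemma uniq_bounded_multiindices N : uniq (bounded_multiindices N).
Proof.
rewrite map_inj_uniq ?enum_uniq // => f g /ffunP fg; apply/ffunP => j.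
by apply: val_inj; have := fg j; rewrite !ffunE.
Qed.

Lemma mem_bounded_multiindices N k :
  (forall j, (k j <= N)%N) -> k \in bounded_multiindices N.
Proof.
move=> kN; apply/mapP; exists [ffun j => inord (k j)]; first by rewrite mem_enum.
by apply/ffunP => j; rewrite !ffunE inordK // ltnS.
Qed.

Lemma cycle_weightE (F : fieldType) s (x : 'I_p -> F) N l : (forall j, (s j <= N)%N) ->
  cycle_weight s x l =
  \sum_(k <- bounded_multiindices N) (signed_binom s k)%:~R * mpow x k ^+ l.
Proof.
move=> sN; rewrite /cycle_weight big_map big_enum /=.
under eq_bigr do rewrite (exprB1_widen _ _ _ N) //.
rewrite bigA_distr_bigA; apply: eq_bigr => f _ /=.
rewrite big_split /= /signed_binom rmorph_prod /mpow -prodrXl; congr (_ * _).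
  by apply: eq_bigr => j _; rewrite ffunE.
by apply: eq_bigr => j _; rewrite ffunE exprAC.
Qed.

Lemma signed_binom_eq0 s k j : (s j < k j)%N -> signed_binom s k = 0.
Proof. by move=> sk; rewrite /signed_binom (bigD1 j) //= bin_small // !mul0r. Qed.

Lemma normr_mpow_lt1 (F : numFieldType) (x : 'I_p -> F) k :
  (forall j, `|x j| < 1) -> k <> [ffun => 0%N] -> `|mpow x k| < 1.
Proof.
move=> x1 k0; have [j kj] : exists j, k j != 0%N.
  apply/existsP; apply: contra_notT k0; rewrite negb_exists => /forallP k0.
  by apply/ffunP => j; rewrite ffunE; apply/eqP/negPn/k0.
rewrite normr_prod (bigD1 j) //=; apply: le_lt_trans (_ : `|x j| ^+ k j < 1).
  rewrite normrX ler_piMr ?exprn_ge0 //; apply: prodr_ile1 => i _.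
  by rewrite normr_ge0 normrX exprn_ile1 // ltW.
by rewrite exprn_ilt1.
Qed.

End CycleWeight.

Theorem theorem2p13 (R : realType) (p : nat) (hp : (1 <= p)%N)
    (s : 'I_p -> nat) (x : 'I_p -> R[i]) (hx : forall k : 'I_p, `|x k| < 1) :
  (fun n : nat => unif_expect (fun sigma : 'S_n => Zpoly s x sigma)) @ \oo -->
  (\big[*%R/1]_(k \in [set k : {ffun 'I_p -> nat} | k <> [ffun => 0%N]])
      (1 - mpow x k) ^ (- signed_binom s k) : R[i]^o).
Proof.
(* Any common bound on the [s j] serves here. *)
pose N := (\sum_j s j)%N.
have sN j : (s j <= N)%N by rewrite /N (bigD1 j) //= leq_addr.
pose z : {ffun 'I_p -> nat} := [ffun => 0%N].
pose r := bounded_multiindices p N.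
have x1 k : k != z -> `|mpow x k| < 1 by move=> /eqP; exact: normr_mpow_lt1.
have -> : \big[*%R/1]_(k \in [set k : {ffun 'I_p -> nat} | k <> [ffun => 0%N]])
    (1 - mpow x k) ^ (- signed_binom s k) =
  \prod_(k <- r | k != z) (1 - mpow x k) ^ (- signed_binom s k).
  rewrite (fsbigE [seq k <- r | k != z]).
  - rewrite big_filter_cond; apply: eq_bigl => k.
    by apply: andb_idr => /eqP kz; exact/mem_set.
  - exact/filter_uniq/uniq_bounded_multiindices.
  - by move=> k /=; rewrite mem_filter => /andP[/eqP].
  (* Outside [r] some [k j] exceeds [s j], so the exponent is [0] and the factor [1]: the product is
     finite. *)
  move=> k /eqP kz; rewrite mem_filter kz /= => kr.
  have [j sk] : exists j, (s j < k j)%N.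
    apply/existsP; apply: contraNT kr; rewrite negb_exists => /forallP ks.
    apply: mem_bounded_multiindices => j; apply: leq_trans (sN j).
    by rewrite leqNgt; exact: ks.
  by rewrite (signed_binom_eq0 _ _ k j sk) oppr0 expr0z.
have [a arec alim] := exp_limit_prod R _ r (fun k => k != z) (mpow x) (signed_binom s) x1.
(* The means obey the same recursion as [a], hence equal it. *)
rewrite (_ : (fun n => _) = a) //; apply/funext; apply: exp_rec_uniq arec.
split=> [|n]; first exact: unif_expect_Zpoly0.
rewrite unif_expect_Zpoly_rec; apply: eq_bigr => l _; congr (_ * _).
(* The zero multi-index supplies the leading [1] of the weights in [exp_limit_prod]. *)
rewrite (cycle_weightE _ _ _ _ N) // (bigD1_seq z) /=; last 2 first.
- by apply: mem_bounded_multiindices => j; rewrite ffunE.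
- exact: uniq_bounded_multiindices.
congr (_ + _); rewrite /signed_binom /mpow !big1 ?mul1r ?expr1n // => j _.
  by rewrite ffunE expr0.
by rewrite ffunE bin0.
Qed.
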